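(* Let $G$ be a finite connected graph. Then $G$ is $\mathcal{C}$-$\mathrm{HH}$ if and only if $G$ is one of the following: (i) $K_1$; (ii) a $K_n$-treelike graph for some $n \ge 2$; (iii) a graph in which every induced cycle is a square (an induced $4$-cycle) and in which the two-squares graph does not embed; (iv) a bipartite graph, with bipartition $(X,Y)$, such that each part has a common neighbour, i.e. there is a vertex adjacent to every vertex of $X$ and a vertex adjacent to every vertex of $Y$; (v) the bipartite complement of a perfect matching $\overline{L(K_{2,n})}$ for some $n \ge 3$.
   Context: Graphs are simple. ''Subgraph'' always means induced subgraph, and ''$H$ embeds in $G$'' means $H$ is isomorphic to an induced subgraph of $G$. A homomorphism of graphs is a map on vertices sending edges to edges; an endomorphism of $G$ is a homomorphism $G \to G$. A graph $G$ is $\mathcal{C}$-$\mathrm{HH}$ if every homomorphism from a finite connected induced subgraph of $G$ into $G$ extends to an endomorphism of $G$. For $n \ge 2$, a $K_n$-treelike graph is a finite connected graph $G$ whose vertex set is covered by a family of $n$-element vertex sets (components), each inducing a complete graph $K_n$, such that every edge of $G$ lies inside some component, two distinct components share at most one vertex, and every induced cycle of $G$ has all its vertices inside a single component (i.e. $G$ is built from copies of $K_n$ by identifying single vertices of distinct copies without creating new induced cycles). In particular $K_n$ itself is $K_n$-treelike, and the $K_2$-treelike graphs are exactly the finite trees. The two-squares graph is the $6$-cycle $v_1v_2v_3v_4v_5v_6v_1$ together with the single chord $v_3v_6$. The bipartite complement of a perfect matching $\overline{L(K_{2,n})}$ is the bipartite graph with parts $\{x_1,\dots,x_n\}$ and $\{y_1,\dots,y_n\}$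 in which $x_i \sim y_j$ if and only if $i \neq j$. *)

(* Defs.v *)
From mathcomp Require Import all_boot.
Set Implicit Arguments. Unset Strict Implicit. Unset Printing Implicit Defensive.

Section Graphs.
Variable T : finType.
Variable e : rel T.

Definition simple_graph := symmetric e /\ irreflexive e.

Definition induced_rel (S : {set T}) : rel T :=
  fun x y => [&& x \in S, y \in S & e x y].

Definition connected_graph := (0 < #|T|) /\ forall x y : T, connect e x y.

Definition connected_set (S : {set T}) :=
  forall x y, x \in S -> y \in S -> connect (induced_rel S) x y.

Definition hom_on (S : {set T}) (f : T -> T) :=
  forall x y, x \in S -> y \in S -> e x y -> e (f x) (f y).

Definition endomorphism (g : T -> T) := forall x y, e x y -> e (g x) (g y).

Definition CHH :=
  forall (S : {set T}) (f : T -> T), connected_set S -> hom_on S f ->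
    exists g : T -> T, endomorphism g /\ forall x, x \in S -> g x = f x.

Definition embeds (U : finType) (h : rel U) :=
  exists f : U -> T, injective f /\ forall a b, e (f a) (f b) = h a b.

Definition isomorphic (U : finType) (h : rel U) :=
  exists f : U -> T, bijective f /\ forall a b, e (f a) (f b) = h a b.

End Graphs.

Definition cycle_rel (k : nat) : rel 'I_k :=
  fun i j => (val j == (val i).+1 %% k) || (val i == (val j).+1 %% k).

Definition induced_cycle (T : finType) (e : rel T) (k : nat) (c : 'I_k -> T) :=
  [/\ 3 <= k, injective c & forall i j, e (c i) (c j) = cycle_rel i j].

Definition is_clique (T : finType) (e : rel T) (A : {set T}) :=
  forall x y, x \in A -> y \in A -> x != y -> e x y.

(* K_n-treelike (G assumed finite connected separately) *)
Definition Kn_treelike (T : finType) (e : rel T) (n : nat) :=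
  exists C : {set {set T}},
    [/\ forall A, A \in C -> #|A| = n /\ is_clique e A,
        forall x : T, exists2 A, A \in C & x \in A,
        forall x y, e x y -> exists2 A, A \in C & (x \in A) && (y \in A),
        forall A B, A \in C -> B \in C -> A != B -> #|A :&: B| <= 1 &
        forall k (c : 'I_k -> T), induced_cycle e c ->
          exists2 A, A \in C & forall i, c i \in A].

(* two-squares graph: 6-cycle v1..v6 (here 0..5) plus chord v3v6 (here 2--5) *)
Definition two_squares_rel : rel 'I_6 :=
  fun i j => cycle_rel i j || ((val i == 2) && (val j == 5)) || ((val i == 5) && (val j == 2)).

Definition bcpm_rel (n : nat) : rel (sum 'I_n 'I_n) :=
  fun a b => match a, b with
             | inl i, inr j => i != j
             | inr j, inl i => i != j
             | _, _ => false
             end.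

Definition case_iii (T : finType) (e : rel T) :=
  (forall k (c : 'I_k -> T), induced_cycle e c -> k = 4) /\ ~ embeds e two_squares_rel.

Definition bipartition (T : finType) (e : rel T) (X Y : {set T}) :=
  [/\ [disjoint X & Y], X :|: Y = setT,
      forall x y, x \in X -> y \in X -> ~~ e x y &
      forall x y, x \in Y -> y \in Y -> ~~ e x y].

Definition case_iv (T : finType) (e : rel T) :=
  exists X Y : {set T},
    [/\ bipartition e X Y,
        exists u, forall x, x \in X -> e u x &
        exists w, forall y, y \in Y -> e w y].

(* Main.v *)
Require Import Defs.
From mathcomp Require Import all_boot.
From mathcomp Require Import zify.
Set Implicit Arguments. Unset Strict Implicit. Unset Printing Implicit Defensive.

(** CHH amounts to a one-point property: for every homomorphism [f] on a connected set [S]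
    and every vertex [v], the images under [f] of the neighbours of [v] in [S] have a common
    neighbour.

    Sufficiency. In a treelike graph the neighbours of [v] in [S] lie in one component; in case
    (iii) they have a common neighbour [u] in [S], so that [f u] works; in cases (iv) and (v)
    their images lie in one colour class and, in case (v), do not exhaust it.

    Necessity. If there is a triangle, let [n] be the clique number. A vertex with two neighbours
    in an [n]-clique lies in that clique, and an induced path [p 0 .. p m] closed by a vertex [v]
    into a hole is excluded by mapping a third vertex of the clique through [v] and [p 0] to [v].
    If there is no triangle, the graph is bipartite. A hole of length at least 6, or an induced
    two-squares graph, forces any two vertices of one colour to have a common neighbour. If then
    some colour class has no common neighbour, a smallest subset of it without one, together with
    common neighbours of its maximal proper subsets, induces the bipartite complement of a perfect
    matching, and no edge leaves this subgraph. *)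

(* [lia] would case-split on every boolean hypothesis that is not arithmetic. *)
Ltac arith := repeat match goal with
  | H : is_true (in_mem _ _) |- _ => clear H
  | H : is_true (negb (in_mem _ _)) |- _ => clear H
  | H : is_true (?f _ _) |- _ => is_var f; clear H
  | H : is_true (negb (?f _ _)) |- _ => is_var f; clear H
  | H : forall _, _ |- _ => clear H
  end; lia.

(** * Induced paths, and how they open and close induced cycles *)

Section InducedPaths.
Variables (T : finType) (e : rel T).
Hypotheses (sym : symmetric e) (irr : irreflexive e).
Implicit Types (S A B : {set T}) (p q : nat -> T).

Lemma connect_induced_sym S : connect_sym (induced_rel e S).
Proof.
by apply: sym_connect_sym => x y; rewrite /induced_rel sym andbCA.
Qed.

Lemma connect_induced_sub S S' x y :
  S \subset S' -> connect (induced_rel e S) x y -> connect (induced_rel e S') x y.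
Proof.
move=> /subsetP sub; apply: connect_sub => {}x {}y /and3P[xS yS exy].
by apply: connect1; rewrite /induced_rel !sub.
Qed.

Lemma induced_edge_connect S x y :
  x \in S -> y \in S -> e x y -> connect (induced_rel e S) x y.
Proof. by move=> xS yS exy; apply: connect1; rewrite /induced_rel xS yS. Qed.

Lemma connected_set_root S r :
  (forall x, x \in S -> connect (induced_rel e S) r x) -> connected_set e S.
Proof.
move=> H x y xS yS; apply: (connect_trans (y := r)); last exact: H.
by rewrite connect_induced_sym; apply: H.
Qed.

Lemma connected_set1 x : connected_set e [set x].
Proof. by move=> a b /set1P-> /set1P->; apply: connect0. Qed.

Lemma connected_setU1 S s v :
  connected_set e S -> s \in S -> e s v -> connected_set e (v |: S).
Proof.
move=> cS sS esv; apply: (@connected_set_root _ s) => x /setU1P[->|xS].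
  by apply: induced_edge_connect; rewrite ?setU11 // setU1r.
exact: connect_induced_sub (subsetU1 _ _) (cS _ _ sS xS).
Qed.

Lemma is_clique_connected_set S : is_clique e S -> connected_set e S.
Proof.
move=> clS x y xS yS; case: (eqVneq x y) => [->|nxy]; first exact: connect0.
by apply: induced_edge_connect => //; apply: clS.
Qed.

Lemma connected_set_closed (P : pred T) S x :
  connected_set e S -> x \in S -> P x ->
  (forall s t, s \in S -> t \in S -> e s t -> P s -> P t) ->
  forall y, y \in S -> P y.
Proof.
move=> cS xS Px step y yS; case/connectP: (cS _ _ xS yS) => p.
elim: p x xS Px => [|a p IH] x xS Px /=; first by move=> _ ->.
case/andP=> /and3P[_ aS exa] pth; apply: IH => //; exact: step Px.
Qed.

(** The number [m] counts edges, so the vertices are [p 0 .. p m]; values of [p] beyond [m] are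
    unconstrained, which makes prefixes and shifts of paths immediate. *)
Definition induced_path m p := forall i j, i < j <= m ->
  p i != p j /\ e (p i) (p j) = (j == i.+1).

Lemma induced_path_inj m p i j :
  induced_path m p -> i <= m -> j <= m -> p i = p j -> i = j.
Proof.
move=> ip im jm pij.
case: (ltngtP i j) => // ij.
  by have [] := ip i j; rewrite ?ij ?jm ?pij ?eqxx.
by have [] := ip j i; rewrite ?ij ?im ?pij ?eqxx.
Qed.

Lemma induced_path_edge m p i j : induced_path m p -> i <= m -> j <= m ->
  e (p i) (p j) = (j == i.+1) || (i == j.+1).
Proof.
move=> ip im jm; case: (ltngtP i j) => ij.
- have ijm : i < j <= m by arith.
  have [_ ->] := ip _ _ ijm.
  by arith.
- have jim : j < i <= m by arith.
  rewrite sym; have [_ ->] := ip _ _ jim.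
  by arith.
- by rewrite ij irr; arith.
Qed.

Lemma induced_path_prefix m m' p : m' <= m -> induced_path m p -> induced_path m' p.
Proof. by move=> le ip i j ij; apply: ip; arith. Qed.

Definition path_set m p : {set T} := [set p i | i : 'I_m.+1].

Lemma mem_path_set m p i : i <= m -> p i \in path_set m p.
Proof. by move=> im; apply/imsetP; exists (inord i) => //; rewrite inordK. Qed.

Lemma path_setP m p x : reflect (exists2 i, i <= m & x = p i) (x \in path_set m p).
Proof.
apply: (iffP imsetP) => [[i _ ->]|[i im ->]]; first by exists i => //; case: i.
by exists (inord i) => //; rewrite inordK.
Qed.

Lemma path_set_connected m p :
  (forall i, i < m -> e (p i) (p i.+1)) -> connected_set e (path_set m p).
Proof.
move=> step; apply: (@connected_set_root _ (p 0)) => _ /path_setP[i im ->].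
elim: i im => [|i IH] im; first exact: connect0.
apply: connect_trans (IH (ltnW im)) _.
by apply: induced_edge_connect; rewrite ?mem_path_set ?step // ltnW.
Qed.

Lemma induced_path_step m p i : induced_path m p -> i < m -> e (p i) (p i.+1).
Proof. by move=> ip im; rewrite (induced_path_edge ip) ?eqxx // ltnW. Qed.

(** A shortest walk inside [S] is induced, since a repeated vertex or a chord would shorten it. *)
Lemma ex_induced_path S a b : connected_set e S -> a \in S -> b \in S ->
  exists m p, [/\ p 0 = a, p m = b, forall i, i <= m -> p i \in S & induced_path m p].
Proof.
move=> cS aS bS.
pose W m := exists p, [/\ p 0 = a, p m = b, forall i, i <= m -> p i \in S &
                       forall i, i < m -> e (p i) (p i.+1)].
have [m Wm] : exists m, W m.
  case/connectP: (cS _ _ aS bS) => s pth bE; exists (size s), (nth a (a :: s)).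
  have allS : all (mem S) (a :: s).
    rewrite /= aS /=; elim: s {1}a pth {bE} => //= c s IH d /andP[/and3P[_ cS' _] pth].
    by rewrite cS'; apply: IH pth.
  split=> // [|i im|i im]; first by rewrite bE nth_last.
    by apply: (allP allS); rewrite mem_nth.
  by move/(pathP a): pth => /(_ i im) /and3P[].
elim/ltn_ind: m Wm => m IH [p [p0 pm pS pe]].
pose good (ij : 'I_m.+1 * 'I_m.+1) := (ij.1 < ij.2) ==>
  ((p ij.1 != p ij.2) && (e (p ij.1) (p ij.2) == (ij.2 == ij.1.+1 :> nat))).
case: (boolP [forall ij, good ij]) => [/forallP all_good|].
  exists m, p; split=> // i j ij; have [im jm] : i < m.+1 /\ j < m.+1 by arith.
  have /= := all_good (Ordinal im, Ordinal jm).
  by rewrite /good /=; case/andP: ij => -> _ /andP[-> /eqP ->].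
rewrite negb_forall => /existsP[[[i im] [j jm]]]; rewrite /good /=.
rewrite negb_imply => /andP[ij]; rewrite negb_and negbK => bad.
(* A repetition [p i = p (i + d)] saves [d] edges of the walk; a chord replaces [d] edges by one and
   saves [d.-1]. *)
have shortcut d : 0 < d -> i + d <= m ->
    (p i = p (i + d) \/ 1 < d /\ e (p i) (p (i + d))) -> exists m', m' < m /\ W m'.
  move=> d0 dm [peq|[d1 pedge]].
    exists (m - d); split; first by arith.
    exists (fun l => if l <= i then p l else p (l + d)); split=> [//| |l lm|l lm].
    - case: ifP => [lei|_]; last by rewrite subnK //; arith.
      have -> : m - d = i by arith.
      by rewrite peq -pm; congr p; arith.
    - by case: ifP => _; apply: pS; arith.
    - case: (leqP l i) => li; case: (leqP l.+1 i) => l1; try arith.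
      + by apply: pe; arith.
      + have -> : l = i by arith.
        by rewrite peq; rewrite addSn; apply: pe; arith.
      + by rewrite addSn; apply: pe; arith.
  exists (m - d.-1); split; first by arith.
  exists (fun l => if l <= i then p l else p (l + d.-1)); split=> [//| |l lm|l lm].
  - case: ifP => [lei|_]; first by arith.
    by rewrite -pm; congr p; arith.
  - by case: ifP => _; apply: pS; arith.
  - case: (leqP l i) => li; case: (leqP l.+1 i) => l1; try arith.
    + by apply: pe; arith.
    + have -> : l = i by arith.
      by have -> : i.+1 + d.-1 = i + d by arith.
    + by rewrite addSn; apply: pe; arith.
have [m' [m'm Wm']] : exists m', m' < m /\ W m'.
  apply: (shortcut (j - i)); [arith|arith|rewrite subnKC; last exact: ltnW].
  case/orP: bad => [/eqP|]; first by left.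
  case: (eqVneq j i.+1) => [->|nij]; first by rewrite pe //; arith.
  case ee: (e _ _) => // _; right; split=> //; arith.
exact: IH m'm Wm'.
Qed.

(** The cycle is opened at [c ord0]: the other [k - 1] vertices form a path with [k - 2] edges, of
    which [v] sees only the two ends. *)
Lemma induced_cycle_path k (c : 'I_k -> T) : induced_cycle e c ->
  exists v p, [/\ induced_path (k - 2) p, forall i, i <= k - 2 -> v != p i &
    forall i, i <= k - 2 -> e v (p i) = (i == 0) || (i == k - 2)].
Proof.
case=> k3 injc ec; have k0 : 0 < k by arith.
case: k k3 k0 c injc ec => // k k3 _ c injc ec.
exists (c ord0), (fun i => c (inord i.+1)); split=> [i j ij|i ik|i ik].
- rewrite ec (inj_eq injc) /cycle_rel -val_eqE /= !inordK; try arith.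
  split; first by arith.
  have [jk|jk] := eqVneq j.+1 k.
    by rewrite jk modnn modn_small; arith.
  by rewrite !modn_small; arith.
- by rewrite (inj_eq injc) -val_eqE /= inordK; arith.
rewrite ec /cycle_rel /= inordK; last by arith.
rewrite modn_small; last by arith.
have [ik'|ik'] := eqVneq i.+2 k.+1; first by rewrite ik' modnn; arith.
by rewrite modn_small; arith.
Qed.

(** Inverse to opening a cycle: index 0 goes to [v] and index [i.+1] to [p i]. For [m = 1] the cycle
    is a triangle. *)
Lemma induced_path_cycle m p v : 0 < m -> induced_path m p ->
  (forall i, i <= m -> v != p i) ->
  (forall i, i <= m -> e v (p i) = (i == 0) || (i == m)) ->
  exists c : 'I_m.+2 -> T, [/\ induced_cycle e c, c ord0 = v &
    forall i, i <= m -> c (inord i.+1) = p i].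
Proof.
move=> m0 ip vp evp.
exists (fun i : 'I_m.+2 => if val i is i'.+1 then p i' else v); split=> //.
  split=> [//|[[|i] im] [[|j] jm] /=|[[|i] im] [[|j] jm] /=].
  - by move=> _; apply: val_inj.
  - by move=> vpj; have := vp j jm; rewrite vpj eqxx.
  - by move=> vpi; have := vp i im; rewrite vpi eqxx.
  - by move=> pij; apply: val_inj; rewrite /= (induced_path_inj ip _ _ pij).
  - by rewrite irr /cycle_rel /= modn_small.
  - rewrite evp // /cycle_rel /= (@modn_small 1) //.
    have [->|jm'] := eqVneq j m; first by rewrite modnn; arith.
    by rewrite modn_small; arith.
  - rewrite sym evp // /cycle_rel /= (@modn_small 1) //.
    have [->|jm'] := eqVneq i m; first by rewrite modnn; arith.
    by rewrite modn_small; arith.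
  - rewrite (induced_path_edge ip) // /cycle_rel /=.
    have [->|im'] := eqVneq i m.
      have [->|jm'] := eqVneq j m; first by rewrite modnn; arith.
      by rewrite modnn modn_small; arith.
    have [->|jm'] := eqVneq j m; first by rewrite modnn modn_small; arith.
    by rewrite !modn_small; arith.
by move=> i im; rewrite [val _]inordK.
Qed.

End InducedPaths.

(** * Extension by one vertex, and sufficiency of the two bipartite cases *)

Section OnePointExtension.
Variables (T : finType) (e : rel T).
Hypotheses (sym : symmetric e) (irr : irreflexive e).
Hypothesis conn : forall x y, connect e x y.
Implicit Types (S A B : {set T}) (p q : nat -> T).

(** Induction on the number of vertices outside [S]: as the graph is connected, a nonempty set that
    no edge leaves is everything. *)
Lemma connected_growth (P : {set T} -> Prop) S x :
  connected_set e S -> x \in S -> P S ->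
  (forall S s v, connected_set e S -> P S -> s \in S -> v \notin S -> e s v ->
    P (v |: S)) ->
  P setT.
Proof.
move=> cS xS PS grow; move: {2}(#|~: S|) (leqnn #|~: S|) => n.
elim: n S cS xS PS => [|n IH] S cS xS PS len.
  suff <- : S = setT by [].
  by apply/eqP; rewrite eqEcard subsetT cardsT -(cardsC S); arith.
case: (boolP [forall s, forall v, (s \in S) && e s v ==> (v \in S)]) => [cl|].
  suff <- : S = setT by [].
  apply/setP => y; rewrite inE; case/connectP: (conn x y) => p.
  elim: p x xS {IH} => [|a p IHp] x xS /=; first by move=> _ ->.
  case/andP=> exa; apply: IHp.
  by move/forallP/(_ x)/forallP/(_ a): cl; rewrite xS exa.
rewrite negb_forall => /existsP[s]; rewrite negb_forall => /existsP[v].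
rewrite negb_imply => /andP[/andP[sS esv] vS].
apply: (IH (v |: S)); first exact: connected_setU1 sS esv.
- exact: setU1r.
- exact: grow sS vS esv.
- have := cardsC S; have := cardsC (v |: S); rewrite cardsU1 vS; arith.
Qed.

Lemma neighbour_of_connected (x y v : T) : x != y -> exists w, e v w.
Proof.
move=> nxy; have [z nzv] : exists z, z != v.
  by case: (eqVneq x v) => [<-|]; [exists y; rewrite eq_sym|exists x].
case/connectP: (conn v z) => [[|w p]] /=; first by move=> _ zv; rewrite zv eqxx in nzv.
by case/andP=> evw _ _; exists w.
Qed.

Lemma CHH_of_one_point :
  (forall S f s v, connected_set e S -> hom_on e S f ->
     s \in S -> v \notin S -> e s v ->
     exists w, forall x, x \in S -> e x v -> e (f x) w) ->
  CHH e.
Proof.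
move=> one S f cS hf; have [->|[x xS]] := set_0Vmem S.
  by exists id; split=> // y; rewrite inE.
have [||_ [g [hg gf]]] := @connected_growth
  (fun S' => S \subset S' /\ exists g, hom_on e S' g /\ forall y, y \in S -> g y = f y)
  S x cS xS; last 1 first.
- by exists g; split=> // a b; apply: hg; rewrite inE.
- by split=> //; exists f.
move=> S' s v cS' [SS' [g [hg gf]]] sS' vS' esv; split.
  exact: subset_trans SS' (subsetU1 _ _).
have [w hw] := one _ _ _ _ cS' hg sS' vS' esv.
exists (fun y => if y == v then w else g y); split=> [a b|y yS]; last first.
  case: eqP => [yv|_]; last exact: gf.
  by rewrite -yv (subsetP SS') in vS'.
have neq z : z \in S' -> (z == v) = false.
  by move=> zS; apply: contraNF vS' => /eqP <-.
case/setU1P=> [->|aS] /setU1P[->|bS]; rewrite ?eqxx ?neq //.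
- by rewrite irr.
- by move=> evb; rewrite sym hw // sym.
- exact: hw.
- exact: hg.
Qed.

(** The value at [v] of an endomorphism extending [f] is the common neighbour. *)
Lemma CHH_common_neighbour S f v : CHH e -> connected_set e S -> hom_on e S f ->
  exists w, forall x, x \in S -> e x v -> e (f x) w.
Proof.
move=> chh cS hf; have [g [hg gf]] := chh S f cS hf.
by exists (g v) => x xS exv; rewrite -gf //; apply: hg.
Qed.

Section TwoColoured.
Variable col : pred T.
Hypothesis colP : forall x y, e x y -> col x != col y.

Lemma colour_hom S f : connected_set e S -> hom_on e S f ->
  forall x y, x \in S -> y \in S -> col x = col y -> col (f x) = col (f y).
Proof.
move=> cS hf x y xS yS cxy.
(* Whether [f] preserves the colour of a vertex is constant on [S]: across an edge both colours
   flip. *)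
suff /eqP : col (f x) (+) col x == col (f y) (+) col y.
  by rewrite cxy => /addIb.
apply: (@connected_set_closed _ e (fun z => col (f x) (+) col x == col (f z) (+) col z)
  S x cS xS _ _ _ yS) => [//|s t sS tS est /eqP->].
have := colP est; have := colP (hf _ _ sS tS est).
by do 4!case: (col _).
Qed.

Lemma CHH_of_common_neighbours u w :
  (forall x, col x -> e u x) -> (forall x, ~~ col x -> e w x) -> CHH e.
Proof.
move=> hu hw; apply: CHH_of_one_point => S f s v cS hf sS vS esv.
exists (if col (f s) then u else w) => x xS exv.
have cxs : col x = col s.
  by have := colP exv; have := colP esv; do 3!case: (col _).
have := colour_hom cS hf xS sS cxs; rewrite sym.
by case: ifP => [|/negbT] c cfx; [apply: hu|apply: hw]; rewrite cfx.
Qed.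

End TwoColoured.

(** Each vertex has a colour and an index, and adjacency means that both differ. The images of the
    neighbours of [v] share a colour and miss some index [i]; the vertex of the other colour with
    index [i] is adjacent to all of them. *)
Lemma crown_CHH n : isomorphic e (@bcpm_rel n) -> CHH e.
Proof.
case=> h [[h' hK h'K] eh].
have e_h' x y : e x y = bcpm_rel (h' x) (h' y) by rewrite -eh !h'K.
pose col x := if h' x is inl _ then true else false.
pose idx x := match h' x with inl i => i | inr i => i end.
have hE x : x = h (if col x then inl (idx x) else inr (idx x)).
  by rewrite -{1}[x]h'K /col /idx; case: (h' x).
have eE x y : e x y = (col x != col y) && (idx x != idx y).
  by rewrite e_h' /col /idx; case: (h' x) => a; case: (h' y) => b //=; rewrite eq_sym.
have colP x y : e x y -> col x != col y by rewrite eE => /andP[].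
apply: CHH_of_one_point => S f s v cS hf sS vS esv.
pose N := [set x in S | e x v].
have cN x : x \in N -> col x = col s.
  by rewrite inE => /andP[_ /colP]; have := colP _ _ esv; do 3!case: (col _).
have cfN x : x \in N -> col (f x) = col (f s).
  by move=> xN; apply: (colour_hom colP cS hf); rewrite ?cN //; case/setIdP: xN.
pose I := [set idx (f x) | x in N].
have [i iI] : exists i, i \notin I.
  (* Neighbours of [v] share a colour, hence have distinct indices, and the index of [v] is not
     among these. *)
  have : #|I| < n.
    apply: leq_ltn_trans (leq_imset_card _ _) _.
    have idx_inj : {in N &, injective idx}.
      by move=> x y xN yN ixy; rewrite (hE x) (hE y) ixy !cN.
    rewrite -(card_in_imset idx_inj) -[X in _ < X]card_ord -cardsT.
    apply: proper_card; rewrite properT; apply/eqP/setP => /(_ (idx v)).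
    rewrite inE; case/imsetP=> x /setIdP[_]; rewrite eE => /andP[_ /eqP ne] ie.
    by case: ne.
  have := cardsC I; rewrite card_ord => cI ltI.
  have /card_gt0P[i] : 0 < #|~: I| by arith.
  by rewrite inE; exists i.
exists (h (if col (f s) then inr i else inl i)) => x xS exv.
have xN : x \in N by rewrite inE xS.
have ni : idx (f x) != i by apply: contraNneq iI => <-; apply: imset_f.
rewrite {1}(hE (f x)) eh cfN //; case: (col (f s)) => //=.
by rewrite eq_sym.
Qed.

End OnePointExtension.

(** * Induced cycles cut out of a path by the neighbours of a vertex *)

Section Sufficiency.
Variables (T : finType) (e : rel T).
Hypotheses (sym : symmetric e) (irr : irreflexive e).
Hypothesis conn : forall x y, connect e x y.
Implicit Types (S A B D : {set T}) (p q : nat -> T).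

Lemma previous_index (P : pred nat) j : P 0 -> 0 < j ->
  exists i, [/\ i < j, P i & forall l, i < l < j -> ~~ P l].
Proof.
move=> P0; elim: j => // j IH _; case: (boolP (P j)) => [Pj|nPj].
  by exists j; split=> // l; arith.
case: j IH nPj => [|j] IH nPj; first by rewrite P0 in nPj.
have [//|i [ij Pi nP]] := IH; exists i; split=> // [|l il]; first by arith.
by have [->//|nl] := eqVneq l j.+1; apply: nP; arith.
Qed.

Lemma induced_path_shift m p i : induced_path e m p -> i <= m ->
  induced_path e (m - i) (fun l => p (l + i)).
Proof.
by move=> ip im a b ab; have [|ne ->] := ip (a + i) (b + i); [|split=> //]; arith.
Qed.

(** No vertex strictly between [p i] and [p j] is adjacent to [v], so [v] closes this segment
    without chords. *)
Lemma consecutive_neighbours_cycle m p v i j :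
  induced_path e m p -> (forall l, l <= m -> v != p l) -> i < j <= m ->
  e v (p i) -> e v (p j) -> (forall l, i < l < j -> ~~ e v (p l)) ->
  exists c : 'I_(j - i).+2 -> T, [/\ induced_cycle e c, c ord0 = v &
    forall l, l <= j - i -> c (inord l.+1) = p (l + i)].
Proof.
move=> ip vp ijm ei ej ne.
apply: (@induced_path_cycle _ _ sym irr _ (fun l => p (l + i))).
- arith.
- apply: (@induced_path_prefix _ _ (m - i)); first by arith.
  by apply: induced_path_shift ip _; arith.
- by move=> l lij; apply: vp; arith.
move=> l lij; have [->|l0] := eqVneq l 0; first by rewrite ei.
have [->|lj] := eqVneq l (j - i); first by rewrite subnK ?ej ?orbT //; arith.
by apply/negbTE/ne; arith.
Qed.

Lemma triangle_induced_cycle a b v : e a b -> e v a -> e v b ->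
  exists c : 'I_3 -> T, [/\ induced_cycle e c, c ord0 = v,
    c (inord 1) = a & c (inord 2) = b].
Proof.
move=> eab eva evb.
have nab x y : e x y -> x != y by apply: contraTneq => ->; rewrite irr.
have [|l|l|c [ic c0 cp]] :=
  @induced_path_cycle _ e sym irr 1 (fun l => if l == 0 then a else b) v isT.
- case=> [|i] [|j] //= ij; try arith.
  by rewrite nab // eab; have -> : j = 0 by arith.
- by move=> _; case: ifP => _; apply: nab.
- by case: l => [|[|l]] //=; rewrite ?eva ?evb.
- by exists c; split=> //; rewrite cp.
Qed.

(** * Sufficiency for treelike graphs *)

Section Treelike.
Variables (n : nat) (C : {set {set T}}).
Hypothesis C_clique : forall A, A \in C -> #|A| = n /\ is_clique e A.
Hypothesis C_cover : forall x : T, exists2 A, A \in C & x \in A.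
Hypothesis C_edge : forall x y, e x y -> exists2 A, A \in C & (x \in A) && (y \in A).
Hypothesis C_meet : forall A B, A \in C -> B \in C -> A != B -> #|A :&: B| <= 1.
Hypothesis C_cycle : forall k (c : 'I_k -> T), induced_cycle e c ->
  exists2 A, A \in C & forall i, c i \in A.

Lemma component_uniq A B x y : A \in C -> B \in C -> x != y ->
  x \in A -> y \in A -> x \in B -> y \in B -> A = B.
Proof.
move=> AC BC nxy xA yA xB yB; apply/eqP/negPn/negP => nAB.
have : #|[set x; y]| <= #|A :&: B|.
  by apply/subset_leq_card/subsetP => z /set2P[] ->; rewrite inE ?xA ?yA.
by rewrite cards2 nxy; have := C_meet AC BC nAB; arith.
Qed.

(** Every further vertex of the clique forms a triangle with a fixed edge. The component containing
    the triangle shares that edge with [B], hence equals [B]. *)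
Lemma clique_in_component A x : is_clique e A -> x \in A ->
  exists2 B, B \in C & A \subset B.
Proof.
move=> clA xA; have [A0|[y /setD1P[nyx yA]]] := set_0Vmem (A :\ x).
  have [B BC xB] := C_cover x; exists B => //.
  by rewrite -(setD1K xA) A0 setU0 sub1set.
have exy : e x y by apply: clA; rewrite // eq_sym.
have [B BC /andP[xB yB]] := C_edge exy.
exists B => //; apply/subsetP => z zA.
have [->//|nzx] := eqVneq z x; have [->//|nzy] := eqVneq z y.
have [|||c [/C_cycle[B' BC' cB'] c0 c1 c2]] := @triangle_induced_cycle x y z.
- exact: exy.
- exact: clA.
- exact: clA.
have := cB' ord0; have := cB' (inord 1); have := cB' (inord 2).
rewrite c0 c1 c2 => yB' xB' zB'.
by rewrite (@component_uniq B B' y x).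
Qed.

(** Follow an induced path in [S] from [s] to [t]. Two consecutive neighbours of [v] on it lie with
    [v] on an induced cycle, hence in one component, so membership in [A] passes from each neighbour
    to the next. *)
Lemma neighbours_in_component S v s : connected_set e S -> s \in S -> v \notin S ->
  e s v -> exists A, [/\ A \in C, v \in A & forall t, t \in S -> e t v -> t \in A].
Proof.
move=> cS sS vS; rewrite sym => evs.
have [A AC /andP[vA sA]] := C_edge evs; exists A; split=> // t tS.
rewrite sym => evt.
have [m [p [p0 pm pS ip]]] := ex_induced_path cS sS tS.
rewrite -p0 in evs; rewrite -pm in evt *.
have vp l : l <= m -> v != p l by move=> lm; apply: contraNneq vS => ->; apply: pS.
have nev l : e v (p l) -> v != p l by move=> evl; apply: contraTneq evl => ->; rewrite irr.
suff inA : forall j, j <= m -> e v (p j) -> p j \in A by apply: inA.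
elim/ltn_ind=> j IH jm evj.
case: (posnP j) => [->|j0]; first by rewrite p0.
have [i [ij evi nP]] := @previous_index (fun i => e v (p i)) j evs j0.
have piA : p i \in A by apply: IH evi; arith.
have [|c [/C_cycle[B BC cB] c0 cp]] :=
  @consecutive_neighbours_cycle m p v i j ip vp _ evi evj nP; first by arith.
have := cB ord0; have := cB (inord 1); have := cB (inord (j - i).+1).
rewrite c0 !cp ?subnK ?add0n // => [pjB piB vB|]; last by arith.
by rewrite (@component_uniq A B v (p i)) // nev.
Qed.

(** The images of the neighbours of [v] form a clique inside a component [B]. There are fewer than
    [n] of them, since [v] itself lies in [A], so [B] has a vertex to spare. *)
Lemma components_CHH : CHH e.
Proof.
apply: CHH_of_one_point => // S f s v cS hf sS vS esv.
have [A [AC vA NA]] := neighbours_in_component cS sS vS esv.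
have [cardA clA] := C_clique AC.
pose N := [set x in S | e x v]; pose K := [set f x | x in N].
have clK : is_clique e K.
  move=> _ _ /imsetP[x /setIdP[xS exv] ->] /imsetP[y /setIdP[yS eyv] ->] nf.
  apply: hf => //; apply: clA; [exact: NA|exact: NA|].
  by apply: contraNneq nf => ->.
have fsK : f s \in K by apply: imset_f; rewrite inE sS.
have [B BC KB] := clique_in_component clK fsK.
have [cardB clB] := C_clique BC.
have ltK : #|K| < #|B|.
  apply: leq_ltn_trans (leq_imset_card _ _) _; rewrite cardB -cardA.
  apply/proper_card/properP; split.
    by apply/subsetP => x /setIdP[xS exv]; apply: NA.
  by exists v; rewrite // inE (negPf vS).
have /properP[_ [w wB wK]] : K \proper B by rewrite properEcard KB.
exists w => x xS exv; have fxK : f x \in K by apply: imset_f; rewrite inE xS.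
apply: clB => //; first exact: (subsetP KB).
by apply: contraNneq wK => <-.
Qed.

End Treelike.

Lemma treelike_CHH n : Kn_treelike e n -> CHH e.
Proof. by case=> C [h1 h2 h3 h4 h5]; exact: components_CHH h1 h2 h3 h4 h5. Qed.

(* A smallest subset of [A] without common neighbour in [D], and for each of its
   elements a common neighbour of all the others. *)
Lemma ex_crown A D : (forall w, w \in D -> exists2 a, a \in A & ~~ e w a) ->
  exists n (x y : 'I_n -> T), [/\ forall i, x i \in A, forall i, y i \in D,
    forall i j, e (x i) (y j) = (i != j) &
    forall w, w \in D -> exists i, ~~ e w (x i)].
Proof.
pose bad B := [forall w in D, exists a in B, ~~ e w a].
move=> hA; have badA : bad A.
  apply/forall_inP => w /hA[a aA na]; apply/exists_inP; by exists a.
have [B /minsetP[badB minB] BA] := minset_exists badA.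
(* By minimality [B :\ a] has a common neighbour in [D]; it is not adjacent to [a], as [B] has
   none. *)
have yP (a : T) : a \in B -> exists y, [&& y \in D & [forall b in B, e y b == (b != a)]].
  move=> aB; have : ~~ bad (B :\ a).
    apply/negP => /minB/(_ (subD1set _ _)) Ba.
    by move: aB; rewrite -Ba setD11.
  rewrite negb_forall => /existsP[y]; rewrite negb_imply negb_exists => /andP[yD].
  move/forallP => ey; exists y; rewrite yD /=.
  have eyb b : b \in B -> b != a -> e y b.
    by move=> bB nba; have := ey b; rewrite in_setD1 nba bB /= negbK.
  apply/forall_inP => b bB; case: (eqVneq b a) => [ba|nba]; last by rewrite eyb.
  have /exists_inP[b' b'B nb'] := forall_inP badB y yD.
  have [b'a|nb'a] := eqVneq b' a; last by rewrite eyb in nb'.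
  by rewrite ba -b'a (negPf nb').
pose x (i : 'I_#|B|) := enum_val i.
have xB i : x i \in B by apply: enum_valP.
pose y i := xchoose (yP (x i) (xB i)).
have yE i : y i \in D /\ forall b, b \in B -> e (y i) b = (b != x i).
  have /andP[yD /forall_inP ey] := xchooseP (yP (x i) (xB i)).
  by split=> // b /ey/eqP.
exists #|B|, x, y; split=> [i|i|i j|w wD].
- exact: (subsetP BA).
- by case: (yE i).
- by rewrite sym; have [_ ->] := yE j; rewrite // (inj_eq enum_val_inj).
have /exists_inP[b bB nb] := forall_inP badB w wD.
by exists (enum_rank_in bB b); rewrite /x enum_rankK_in.
Qed.

(** * Sufficiency for graphs whose induced cycles are squares *)

Section Squares.
Hypothesis squares : forall k (c : 'I_k -> T), induced_cycle e c -> k = 4.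
Hypothesis no_two_squares : ~ embeds e two_squares_rel.

Lemma square_no_triangle a b v : e a b -> e v a -> ~~ e v b.
Proof.
move=> eab eva; apply/negP => evb.
by have [c [/squares]] := triangle_induced_cycle eab eva evb.
Qed.

(** The path is [v1 .. v5] and [v] is [v6]: its neighbours [p 0] and [p 4] close the 6-cycle, and
    [p 2] gives the chord. *)
Lemma two_squares_embeds p v : induced_path e 4 p ->
  (forall l, l <= 4 -> v != p l) -> (forall l, l <= 4 -> e v (p l) = ~~ odd l) ->
  embeds e two_squares_rel.
Proof.
move=> ip vp evp.
exists (fun i : 'I_6 => if val i == 5 then v else p i); split.
  move=> [i im] [j jm] /=; case: eqP => i5; case: eqP => j5.
  - by move=> _; apply: val_inj; rewrite /= i5 j5.
  - by move=> vpj; have := vp j; rewrite vpj eqxx; arith.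
  - by move=> vpj; have := vp i; rewrite vpj eqxx; arith.
  - by move=> pij; apply: val_inj; apply: (induced_path_inj ip _ _ pij) => /=; arith.
move=> [i im] [j jm]; rewrite /two_squares_rel /cycle_rel /=.
case: eqP => i5; case: eqP => j5.
- by rewrite irr i5 j5.
- rewrite evp; last by arith.
  by case: j jm j5 => [|[|[|[|[|[|]]]]]] //= _ _; rewrite i5.
- rewrite sym evp; last by arith.
  by case: i im i5 => [|[|[|[|[|[|]]]]]] //= _ _; rewrite j5.
- rewrite (induced_path_edge sym irr ip); arith.
Qed.

(** On an induced path in [S] from [a] to [b], consecutive neighbours of [v] are two steps apart, as
    they span a square with [v]. Three in a row would give two squares, so the path has length 2 and
    its midpoint is the vertex sought. *)
Lemma common_neighbour_in S v a b : connected_set e S -> v \notin S ->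
  a \in S -> b \in S -> a != b -> e v a -> e v b ->
  exists2 u, u \in S & e u a && e u b.
Proof.
move=> cS vS aS bS nab eva evb.
have [m [p [p0 pm pS ip]]] := ex_induced_path cS aS bS.
have vp l : l <= m -> v != p l by move=> lm; apply: contraNneq vS => ->; apply: pS.
rewrite -p0 in eva; rewrite -pm in evb.
have prev j : 0 < j <= m -> e v (p j) -> exists i,
    [/\ j = i.+2, e v (p i) & ~~ e v (p i.+1)].
  case/andP=> j0 jm evj.
  have [i [ij evi nP]] := @previous_index (fun i => e v (p i)) j eva j0.
  have [|c [/squares k4 _ _]] :=
    @consecutive_neighbours_cycle m p v i j ip vp _ evi evj nP; first by arith.
  by exists i; split=> //; [arith|apply: nP; arith].
have m0 : 0 < m.
  by case: (posnP m) => // m0; rewrite -p0 -pm m0 eqxx in nab.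
have [|i [im evi nev]] := prev m _ evb; first by rewrite m0 /=.
case: (posnP i) => [i0|i0].
  exists (p 1); first by apply: pS; arith.
  by rewrite -p0 -pm !(induced_path_edge sym irr ip); arith.
have [|l [il evl nevl]] := prev i _ evi; first by arith.
case: no_two_squares.
apply: (@two_squares_embeds (fun k => p (k + l)) v) => [|k k4|k k4].
- have -> : 4 = m - l by arith.
  by apply: induced_path_shift ip _; arith.
- by apply: vp; arith.
- move: evb evi nev evl nevl; rewrite im il.
  move=> eb ei /negPf ni el /negPf nl.
  by case: k k4 => [|[|[|[|[|k]]]]] //= _; rewrite ?addSn ?add0n ?eb ?ei ?ni ?el ?nl.
Qed.

Lemma crown_not_squares n (x y : 'I_n -> T) v : 2 < n ->
  (forall i, e v (x i)) -> ~ (forall i j, e (x i) (y j) = (i != j)).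
Proof.
move=> n3 evx exy.
pose o i (lt_i3 : i < 3) : 'I_n := Ordinal (leq_trans lt_i3 n3).
have nx i j : ~~ e (x i) (x j).
  apply/negP => eij; have := square_no_triangle eij (evx i); by rewrite evx.
pose o0 := @o 0 isT; pose o1 := @o 1 isT; pose o2 := @o 2 isT.
have ny i j k : k != i -> k != j -> e (y i) (y j) = false.
  move=> ki kj; apply/negP => eij.
  have := @square_no_triangle (y i) (y j) (x k) eij.
  by rewrite !exy ki kj => /(_ isT).
have eyx i j : e (y i) (x j) = (j != i) by rewrite sym exy.
have nyx i j : y i != x j.
  apply/eqP => yx; have := evx j; rewrite -yx => evy.
  have [k ki] : exists k : 'I_n, k != i.
    by case: (eqVneq o0 i) => [<-|]; [exists o1|exists o0].
  have := square_no_triangle (a := y i) (b := x k) (v := v).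
  by rewrite eyx ki evy evx => /(_ isT isT).
have injx i j : i != j -> x i != x j.
  by move=> ij; apply/eqP => xij; have := exy i j; rewrite xij exy ij eqxx.
have injy i j : i != j -> y i != y j.
  by move=> ij; apply/eqP => yij; have := exy i j; rewrite -yij exy ij eqxx.
(* Together with [x o0] this path forms an induced 6-cycle; triangles through [v] or through some
   [x k] would arise from any other edge. *)
pose p k := nth v [:: y o2; x o1; y o0; x o2; y o1] k.
have [|||c [/squares]] := @induced_path_cycle _ e sym irr 4 p (x o0) isT; last by [].
- move=> i j /andP[ij j4].
  have n01 : e (y o0) (y o1) = false by apply: (@ny _ _ o2).
  have n20 : e (y o2) (y o0) = false by apply: (@ny _ _ o1).
  have n21 : e (y o2) (y o1) = false by apply: (@ny _ _ o0).
  case: i ij => [|[|[|[|i]]]]; case: j j4 => [|[|[|[|[|j]]]]] // _ _;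
  by rewrite /p /= ?exy ?eyx ?n01 ?n20 ?n21 ?(negPf (nx _ _)) ?injx ?injy ?nyx // eq_sym nyx.
- by case=> [|[|[|[|[|l]]]]] // _; rewrite /p /= ?injx // eq_sym nyx.
- by case=> [|[|[|[|[|l]]]]] // _; rewrite /p /= ?exy ?(negPf (nx _ _)).
Qed.

End Squares.

Lemma squares_CHH : case_iii e -> (forall v : T, exists w, e v w) -> CHH e.
Proof.
move=> [squares n2s] nbr; apply: CHH_of_one_point => // S f s v cS hf sS vS esv.
pose N := [set x in S | e x v].
case: (boolP [exists u in S, forall x in N, e u x]) => [/exists_inP[u uS /forall_inP uN]|].
  by exists (f u) => x xS exv; rewrite sym hf // uN // inE xS.
rewrite negb_exists_in => /forall_inP noN.
have [w|n [x [y [xN yS exy nox]]]] := @ex_crown N S.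
  by move/noN; rewrite negb_forall_in => /exists_inP[a aN na]; exists a.
have xS i : x i \in S by case/setIdP: (xN i).
have evx i : e v (x i) by case/setIdP: (xN i); rewrite sym.
have inN a b : a \in N -> b \in N -> a != b -> exists2 u, u \in S & e u a && e u b.
  move=> /setIdP[aS eav] /setIdP[bS ebv] nab.
  by apply: (common_neighbour_in squares n2s cS vS) => //; rewrite sym.
(* Size 0 contradicts [s \in S]. In size 1, [x ord0] has no neighbour in [S], so it is the only
   neighbour of [v] there. Size 2 fails because two neighbours of [v] have a common neighbour in
   [S], and larger sizes contain an induced 6-cycle. *)
case: n x y xN yS exy nox xS evx => [|[|n]] x y xN yS exy nox xS evx.
- by have [[]] := nox s sS.
- have [w fw] := nbr (f (x ord0)); exists w => t tS etv.
  have [->//|ntx] := eqVneq t (x ord0).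
  have [|u uS /andP[_ eux]] := inN t (x ord0) _ (xN _) ntx; first by rewrite inE tS.
  by have [i] := nox u uS; rewrite ord1 eux.
have nx01 : x ord0 != x (lift ord0 ord0).
  apply/eqP => x01; have := exy ord0 ord0; rewrite {1}x01 exy eqxx; exact/eqP.
have [u uS /andP[eu0 eu1]] := inN _ _ (xN _) (xN _) nx01.
have [i neui] := nox u uS.
case: (crown_not_squares squares (n := n.+2) _ evx exy).
case: n x y xN yS exy nox xS evx nx01 eu0 eu1 i neui => // x y _ _ _ _ _ _ _ eu0 eu1 i neui.
have [] : i = ord0 \/ i = lift ord0 ord0.
  by case: i {neui} => [[|[|i]] im] //; [left|right]; apply: val_inj.
all: by move=> ii; rewrite ii ?eu0 ?eu1 in neui.
Qed.

End Sufficiency.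

(** * Consequences of the extension property *)

Section Necessity.
Variables (T : finType) (e : rel T).
Hypotheses (sym : symmetric e) (irr : irreflexive e).
Hypothesis conn : forall x y, connect e x y.
Hypothesis chh : CHH e.
Implicit Types (S A B D : {set T}) (p q : nat -> T).

Let edge_neq x y : e x y -> x != y.
Proof. by apply: contraTneq => ->; rewrite irr. Qed.

(** Boolean form of [is_clique], for maximisation and for set comprehension. *)
Definition cliqueb A := [forall a in A, forall b in A, (a != b) ==> e a b].

Lemma cliqueP A : reflect (is_clique e A) (cliqueb A).
Proof.
apply: (iffP forall_inP) => [h a b aA bA nab|h a aA].
  by have /forall_inP/(_ b bA)/implyP := h a aA; apply.
by apply/forall_inP => b bA; apply/implyP; apply: h.
Qed.

(** * Graphs with a triangle: maximum cliques as components *)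

Section MaximumClique.
Variable n : nat.
Hypothesis n3 : 2 < n.
Hypothesis max_n : forall A, is_clique e A -> #|A| <= n.
Variable A0 : {set T}.
Hypotheses (clA0 : is_clique e A0) (cardA0 : #|A0| = n).

(** An endomorphism taking an edge of [A0] to [x y] is injective on [A0], because adjacent vertices
    have adjacent, hence distinct, images. *)
Lemma edge_in_max_clique x y : e x y ->
  exists A, [/\ #|A| = n, is_clique e A, x \in A & y \in A].
Proof.
move=> exy.
have [a aA0] : exists a, a \in A0 by apply/card_gt0P; arith.
have [b /setD1P[nba bA0]] : exists b, b \in A0 :\ a.
  by apply/card_gt0P; have := cardsD1 a A0; rewrite aA0; arith.
have cab : connected_set e [set a; b].
  apply: is_clique_connected_set => c d /set2P[]-> /set2P[]->; rewrite ?eqxx // => _;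
  by apply: clA0; rewrite // eq_sym.
have [|g [hg gf]] := chh (f := fun z => if z == a then x else y) cab.
  move=> c d /set2P[]-> /set2P[]->; rewrite ?eqxx ?irr ?(negPf nba) //.
  by rewrite (sym y).
have gx : g a = x by rewrite gf ?eqxx ?set21.
have gy : g b = y by rewrite gf ?(negPf nba) ?set22.
have ginj c d : c \in A0 -> d \in A0 -> c != d -> e (g c) (g d).
  by move=> cA dA ncd; apply/hg/clA0.
exists (g @: A0); split.
- rewrite -cardA0; apply: card_in_imset => c d cA dA gcd.
  by apply/eqP/negPn/negP => /(ginj _ _ cA dA)/edge_neq; rewrite gcd eqxx.
- move=> _ _ /imsetP[c cA ->] /imsetP[d dA ->] ncd.
  by apply: ginj => //; apply: contraNneq ncd => ->.
- by rewrite -gx imset_f.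
- by rewrite -gy imset_f.
Qed.

(* Otherwise mapping [b] to [y] and fixing [A :\ y] would extend, the image of [y]
   enlarging the clique [A]. *)
Lemma max_clique_closed A x y b : #|A| = n -> is_clique e A ->
  x \in A -> y \in A -> x != y -> e b x -> e b y -> b \in A.
Proof.
move=> cardA clA xA yA nxy ebx eby; apply: contraT => bA.
have cS : connected_set e (b |: A :\ y).
  apply: (@connected_setU1 _ _ sym _ x).
  - apply: is_clique_connected_set => c d /setD1P[_ cA] /setD1P[_ dA]; exact: clA.
  - by rewrite in_setD1 nxy.
  - by rewrite sym.
have nb c : c \in A -> (c == b) = false.
  by move=> cA; apply: contraNF bA => /eqP <-.
have [|w ew] := CHH_common_neighbour (f := fun z => if z == b then y else z) y chh cS.
  move=> c d /setU1P[->|/setD1P[ncy cA]] /setU1P[->|/setD1P[ndy dA]];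
  rewrite ?eqxx ?nb ?irr // => _; apply: clA => //.
  by rewrite eq_sym.
have ewA a : a \in A -> e a w.
  move=> aA; have [->|nay] := eqVneq a y.
    by have := ew b; rewrite setU11 eqxx; apply.
  by have := ew a; rewrite nb //; apply; [rewrite setU1r // in_setD1 nay|apply: clA].
have wA : w \notin A by apply/negP => /ewA; rewrite irr.
have /max_n : is_clique e (w |: A).
  move=> c d /setU1P[->|cA] /setU1P[->|dA]; rewrite ?eqxx //.
  - by rewrite sym => _; apply: ewA.
  - by move=> _; apply: ewA.
  - exact: clA.
by rewrite cardsU1 wA; arith.
Qed.

Lemma max_clique_no_hole m p v : 1 < m -> induced_path e m p ->
  (forall i, i <= m -> v != p i) ->
  ~ (forall i, i <= m -> e v (p i) = (i == 0) || (i == m)).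
Proof.
elim/ltn_ind: m v => m IH v m2 ip vp evp.
have ev0 : e v (p 0) by rewrite evp.
have evm : e v (p m) by rewrite evp // eqxx orbT.
have n0m : ~~ e (p 0) (p m) by rewrite (induced_path_edge sym irr ip) //; arith.
have [A [cardA clA vA p0A]] := edge_in_max_clique ev0.
have nv0 := edge_neq ev0.
have pmA : p m \notin A.
  apply: contra n0m => pmA; apply: clA => //.
  by apply/eqP => /(induced_path_inj ip (leq0n m) (leqnn m)); arith.
(* As [n] is at least 3, the clique has a third vertex. *)
have [d /setD1P[ndv /setD1P[nd0 dA]]] : exists d, d \in A :\ p 0 :\ v.
  apply/card_gt0P; have := cardsD1 (p 0) A; have := cardsD1 v (A :\ p 0).
  by rewrite in_setD1 nv0 vA p0A; arith.
have edv : e d v by apply: clA.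
have ed0 : e d (p 0) by apply: clA.
have dp i : i <= m -> d != p i.
  move=> im; apply/eqP => dpi.
  by move: edv; rewrite dpi sym evp // => /orP[] /eqP i0; move: nd0 pmA;
    rewrite dpi -?i0 ?eqxx // -dpi dA.
have nedm : ~~ e d (p m).
  apply: contra pmA => edm; apply: (max_clique_closed cardA clA dA vA ndv).
    by rewrite sym.
  by rewrite sym.
have ned1 : ~~ e d (p 1).
  apply/negP => ed1.
  have p1A : p 1 \in A.
    apply: (max_clique_closed cardA clA dA p0A nd0); first by rewrite sym.
    by rewrite sym; apply: (induced_path_step sym irr ip); apply: ltnW.
  have := clA _ _ vA p1A; rewrite vp ?evp; arith.
(* The first neighbour of [d] on the path after [p 0] would close a shorter hole through [d]. *)
case: (boolP [exists j : 'I_m, (0 < j) && e d (p j)]) => [/existsP[j0 /andP[j00 edj0]]|].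
  have ex : exists j, (0 < j) && e d (p j) by exists j0; rewrite j00.
  case: (ex_minnP ex) => j /andP[j1 edj] minj.
  have jj0 : j <= j0 by apply: minj; rewrite j00.
  have jm : j < m by apply: leq_ltn_trans jj0 (ltn_ord j0).
  have j2 : 1 < j by case: j j1 edj {minj jj0 jm} ned1 => [|[|j]] // _ ->.
  apply: (IH j jm d j2) => [|i ij|i ij].
  - by apply: induced_path_prefix ip; apply: ltnW.
  - by apply: dp; arith.
  - have [->|i0] := eqVneq i 0; first by rewrite ed0.
    have [->|nij] := eqVneq i j; first by rewrite edj.
    apply: contraTF ij => edi; rewrite -ltnNge ltn_neqAle eq_sym nij /=.
    by apply: minj; rewrite lt0n i0.
rewrite negb_exists => /forallP ned.
have edp i : i <= m -> e d (p i) -> i = 0.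
  move=> im edi; have [//|i0] := posnP i; have [im'|] := ltnP i m.
    by have := ned (Ordinal im'); rewrite /= i0 edi.
  by move=> mi; have im' : i = m; [arith|move: nedm; rewrite -im' edi].
have cS : connected_set e (d |: path_set m p).
  apply: (@connected_setU1 _ _ sym _ (p 0)); last by rewrite sym.
    by apply: path_set_connected => // i; apply: induced_path_step ip.
  exact: mem_path_set.
have dpE i : i <= m -> (p i == d) = false by move=> im; rewrite eq_sym (negPf (dp i im)).
(* Now [p 0] is the only neighbour of [d] on the path, so [d] may go to [v]. The resulting [w] is
   adjacent to [v], [p 0] and [p m]; it lies in [A], which then forces [p m] into [A]. *)
have [|w ew] := CHH_common_neighbour (f := fun z => if z == d then v else z) v chh cS.
  move=> c c' /setU1P[->|/path_setP[i im ->]] /setU1P[->|/path_setP[j jm ->]];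
  rewrite ?eqxx ?dpE ?irr //.
  - by move/(edp j jm) ->.
  - by rewrite sym => /(edp i im) ->; rewrite sym.
have evw : e v w by have := ew d (setU11 _ _) edv; rewrite eqxx.
have ew0 : e (p 0) w.
  by have := ew (p 0); rewrite dpE //; apply; rewrite ?setU1r ?mem_path_set // sym.
have ewm : e (p m) w.
  by have := ew (p m); rewrite dpE //; apply; rewrite ?setU1r ?mem_path_set // sym.
have wA : w \in A by apply: (max_clique_closed cardA clA vA p0A nv0); rewrite sym.
have nvw := edge_neq evw.
by move: pmA; rewrite (max_clique_closed cardA clA vA wA nvw) // sym.
Qed.

(** The components are the cliques of size [n]. Two of them sharing two vertices coincide, and a
    triangle lies in any component containing one of its edges. *)
Lemma max_clique_treelike : (exists x y : T, x != y) -> Kn_treelike e n.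
Proof.
case=> x [y nxy]; exists [set A : {set T} | (#|A| == n) && cliqueb A].
have CP A : reflect (#|A| = n /\ is_clique e A)
    (A \in [set A : {set T} | (#|A| == n) && cliqueb A]).
  by rewrite inE; apply: (iffP andP) => [[/eqP cA /cliqueP]|[/eqP cA /cliqueP]].
split.
- by move=> A /CP.
- move=> z; have [w ezw] := neighbour_of_connected conn z nxy.
  by have [A [cA clA zA _]] := edge_in_max_clique ezw; exists A => //; apply/CP.
- move=> a b eab; have [A [cA clA aA bA]] := edge_in_max_clique eab.
  by exists A; [apply/CP|rewrite aA].
- move=> A B /CP[cA clA] /CP[cB clB]; apply: contraNT; rewrite -ltnNge => AB.
  have [a aAB] : exists a, a \in A :&: B by apply/card_gt0P; arith.
  have [b /setD1P[nba bAB]] : exists b, b \in (A :&: B) :\ a.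
    by apply/card_gt0P; have := cardsD1 a (A :&: B); rewrite aAB; arith.
  case/setIP: aAB => aA aB; case/setIP: bAB => bA bB.
  rewrite eq_sym eqEcard cA cB leqnn andbT; apply/subsetP => c cinB.
  have [->//|nca] := eqVneq c a; have [->//|ncb] := eqVneq c b.
  by apply: (max_clique_closed cA clA aA bA); rewrite 1?eq_sym //; apply: clB;
    rewrite // eq_sym.
- move=> k c ic; have [k3 injc ec] := ic.
  have [k4|k4] := ltnP 3 k.
    have [v [p [ip vp evp]]] := induced_cycle_path ic.
    by case: (max_clique_no_hole _ ip vp evp); arith.
  have k3' : k = 3 by arith.
  subst k; pose o (i : nat) (i3 : i < 3) := Ordinal i3.
  pose o0 := @o 0 isT; pose o1 := @o 1 isT; pose o2 := @o 2 isT.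
  have e01 : e (c o0) (c o1) by rewrite ec.
  have e20 : e (c o2) (c o0) by rewrite ec.
  have e21 : e (c o2) (c o1) by rewrite ec.
  have [A [cA clA c0A c1A]] := edge_in_max_clique e01.
  exists A; first exact/CP.
  have c2A := max_clique_closed cA clA c0A c1A (edge_neq e01) e20 e21.
  by case=> [[|[|[|i]]] i3] //; [rewrite (_ : Ordinal i3 = o0)|
     rewrite (_ : Ordinal i3 = o1)|rewrite (_ : Ordinal i3 = o2)] => //; apply: val_inj.
Qed.

End MaximumClique.

Lemma triangle_treelike x y z : e x y -> e x z -> e y z ->
  exists2 n, 2 <= n & Kn_treelike e n.
Proof.
move=> exy exz eyz.
have cl_xyz : cliqueb [set x; y; z].
  apply/cliqueP => a b; rewrite !inE -!orbA.
  by do 2!case/or3P=> /eqP->; rewrite ?eqxx // sym.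
have [A clA maxA] := @arg_maxnP _ [set x; y; z] cliqueb (fun A => #|A|) cl_xyz.
have card3 : #|[set x; y; z]| = 3.
  by rewrite setUC cardsU1 cards2 !inE negb_or (edge_neq exy) !(eq_sym z)
    (edge_neq exz) (edge_neq eyz).
exists #|A|; first by have := maxA _ cl_xyz; rewrite card3; arith.
apply: (@max_clique_treelike _ _ _ A) => //.
- by have := maxA _ cl_xyz; rewrite card3; arith.
- by move=> B /cliqueP; apply: maxA.
- exact/cliqueP.
- by exists x, y; apply: edge_neq.
Qed.

(* Mapping a properly 2-coloured connected set onto an edge [x y], the image of a further
   vertex is adjacent to at most one of [x] and [y]; this extends the colouring. *)
Lemma triangle_free_two_colourable x y : e x y ->
  (forall a b c, e a b -> e a c -> e b c -> False) ->
  exists col : pred T, forall s t, e s t -> col s != col t.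
Proof.
move=> exy tf.
pose P S := exists col : pred T, forall s t, s \in S -> t \in S -> e s t -> col s != col t.
suff [col colP] : P setT by exists col => s t; apply: colP; rewrite inE.
refine (@connected_growth _ _ sym conn P [set x] x (@connected_set1 _ e x) (set11 x) _ _).
  by exists predT => s t /set1P-> /set1P->; rewrite irr.
move=> S s v cS [col colP] sS vS esv.
have hf : hom_on e S (fun t => if col t then x else y).
  move=> a b aS bS eab; have := colP _ _ aS bS eab.
  by case: (col a); case: (col b) => // _; rewrite sym.
have [w ew] := CHH_common_neighbour v chh cS hf.
(* As [w] is not adjacent to both [x] and [y], all neighbours of [v] in [S] have the colour
   [e x w]. *)
have cw t : t \in S -> e t v -> col t = e x w.
  move=> tS etv; have := ew t tS etv; case: (col t) => // eyw.
  by apply/esym/negP => exw; apply: (tf x y w).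
exists (fun t => if t == v then ~~ e x w else col t).
have neq z : z \in S -> (z == v) = false.
  by move=> zS; apply: contraNF vS => /eqP <-.
move=> a b /setU1P[->|aS] /setU1P[->|bS]; rewrite ?eqxx ?neq ?irr //.
- by rewrite sym => /(cw b bS)->; case: (e x w).
- by move/(cw a aS)->; case: (e x w).
- exact: colP.
Qed.

(** Since the path is induced, sending [p i] to [q i] is a homomorphism for any walk [q]; an image
    for [v] is then adjacent to both ends of the walk. *)
Lemma walk_common_neighbour m p v : induced_path e m p -> e v (p 0) -> e v (p m) ->
  forall q, (forall i, i < m -> e (q i) (q i.+1)) -> exists w, e (q 0) w && e (q m) w.
Proof.
move=> ip ev0 evm q eq.
pose f t := q (index t (mkseq p m.+1)).
have fE i : i <= m -> f (p i) = q i.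
  move=> im; rewrite /f -[p i](@nth_mkseq _ (p 0) p m.+1) // index_uniq ?size_mkseq //.
  rewrite map_inj_in_uniq ?iota_uniq // => a b; rewrite !mem_iota => am bm.
  by apply: (induced_path_inj ip); arith.
have [||w ew] := @CHH_common_neighbour _ e (path_set m p) f v chh.
- by apply: path_set_connected => // i; apply: induced_path_step ip.
- move=> _ _ /path_setP[i im ->] /path_setP[j jm ->].
  rewrite (induced_path_edge sym irr ip) // !fE // => /orP[]/eqP ij.
    by rewrite ij; apply: eq; rewrite -ij.
  by rewrite sym ij; apply: eq; rewrite -ij.
exists w; rewrite -(fE 0) // -(fE m) // !ew ?mem_path_set //.
  by rewrite sym.
by rewrite sym.
Qed.

(** * Bipartite graphs: common neighbours and crowns *)

Section Bipartite.
Variable col : pred T.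
Hypothesis colP : forall x y, e x y -> col x != col y.
Hypothesis edgeP : forall v : T, exists w, e v w.

Lemma even_walk_common_neighbour m : 3 < m ->
  (forall q, (forall i, i < m -> e (q i) (q i.+1)) -> exists w, e (q 0) w && e (q m) w) ->
  forall x y, col x = col y -> exists w, e x w && e y w.
Proof.
move=> m4 walk x y cxy.
(* For odd [m], a walk back and forth along one edge would give its two ends a common neighbour,
   against the colouring. *)
have m_even : ~~ odd m.
  apply/negP => m_odd; have [z exz] := edgeP x.
  have [|w] := walk (fun i => if odd i then z else x).
    by move=> i _ /=; case: (odd i); rewrite //= sym.
  rewrite /= m_odd => /andP[/colP cxw /colP czw].
  by have := colP exz; move: cxw czw; do 3!case: (col _).
have trans4 a b c d f : e a b -> e b c -> e c d -> e d f -> exists w, e a w && e f w.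
  move=> eab ebc ecd edf.
  (* A walk of length 4 is padded to length [m] by going back and forth between [f] and [d]; the
     default value of [nth] depends on parity and does this. *)
  have [|w /=] := walk (fun i => nth (if odd i then d else f) [:: a; b; c; d; f] i).
    move=> [|[|[|[|i]]]] /= _ //; rewrite nth_nil !negbK.
    by case: i => [|i] /=; rewrite ?nth_nil; [|case: (odd i)]; rewrite //= sym.
  rewrite (negPf m_even) => aw; exists w.
  by case: m m4 aw {walk m_even} => [|[|[|[|[|m]]]]] //= _; rewrite nth_nil.
(* Vertices of equal colour are joined by a walk of length 2, others by one of length 3; a longer
   walk is shortened from 4 to 2 edges. *)
pose near a b := if col a == col b then exists w, e a w && e b w
  else exists c w, [/\ e a w, e c w & e c b].
suff : near x y by rewrite /near cxy eqxx.
case/connectP: (conn x y) => p; elim/last_ind: p y {cxy} => [|p b IH] y.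
  by move=> _ ->; rewrite /near eqxx; have [w exw] := edgeP x; exists w; rewrite exw.
rewrite rcons_path last_rcons => /andP[pth elb] ->.
have := IH _ pth erefl; rewrite /near; have := colP elb.
move: (last x p) elb => a eab nab; case: eqP => [cxa|cxa].
  case=> w /andP[exw eaw]; case: eqP => [cxb|_]; first by rewrite -cxa cxb eqxx in nab.
  by exists a, w.
case=> c [w [exw ecw eca]]; case: eqP => [_|cxb].
  have ewc : e w c by rewrite sym.
  exact: trans4 exw ewc eca eab.
by case: (col x) (col a) (col b) nab cxa cxb => [] [] [].
Qed.

(** A common neighbour of [x j] and [x k] misses some [x l], so [l] differs from both indices. *)
Lemma crown_third (I : finType) (x : I -> T) c :
  (forall a b, col a = col b -> exists w, e a w && e b w) ->
  (forall i, col (x i) = c) ->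
  (forall w, exists i, ~~ e w (x i)) ->
  forall j k : I, exists l, (l != j) && (l != k).
Proof.
move=> near cx nox j k.
have [|w /andP[ejw ekw]] := near (x j) (x k); first by rewrite !cx.
have [l nl] := nox w; exists l.
by apply/andP; split; apply: contraNneq nl => ->; rewrite sym.
Qed.

(* If [y i] had a neighbour [b] outside the crown, mapping [b] to [x i] and fixing the rest
   of the crown except [y i] would extend to [y i], giving the [x j] a common neighbour. *)
Lemma crown_neighbours (I : finType) (x y : I -> T) c :
  (forall a b, col a = col b -> exists w, e a w && e b w) ->
  (forall i j, e (x i) (y j) = (i != j)) ->
  (forall i, col (x i) = c) ->
  (forall w, exists i, ~~ e w (x i)) ->
  forall i b, e (y i) b -> exists j, b = x j.
Proof.
move=> near exy cx nox i b eyb.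
case: (boolP [exists j, b == x j]) => [/existsP[j /eqP ->]|]; first by exists j.
rewrite negb_exists => /forallP nbx.
have third := crown_third near cx nox.
have [k /andP[ki _]] := third i i.
have cb : col b = c.
  have := exy k i; rewrite ki => /colP; rewrite cx.
  by have := colP eyb; do 3!case: (col _); case: c cx.
have [|z /andP[ebz exz]] := near b (x i); first by rewrite cb cx.
(* The crown without [y i], to which [z] attaches [b] so that [R] is connected. *)
pose R : {set T} := b |: (z |: ([set x j | j in I] :|: [set y j | j in I & j != i])).
have xR j : x j \in R by rewrite !inE imset_f ?orbT.
have yR j : j != i -> y j \in R.
  by move=> ji; rewrite /R !inE imset_f ?orbT // inE.
have zR : z \in R by rewrite !inE eqxx orbT.
have bR : b \in R by rewrite !inE eqxx.
have RP t : t \in R -> [\/ t = b, t = z, exists j, t = x j |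
    exists2 j, j != i & t = y j].
  case/setU1P=> [->|/setU1P[->|/setUP[/imsetP[j _ ->]|/imsetP[j]]]].
  - by constructor 1.
  - by constructor 2.
  - by constructor 3; exists j.
  - by rewrite inE => ji ->; constructor 4; exists j.
have xy_connect j : connect (induced_rel e R) (x i) (x j).
  have [l /andP[li lj]] := third i j.
  apply: (connect_trans (y := y l)); apply: induced_edge_connect; rewrite ?yR ?exy //.
    by rewrite eq_sym.
  by rewrite sym exy eq_sym.
have iz : connect (induced_rel e R) (x i) z by apply: induced_edge_connect.
have cR : connected_set e R.
  apply: (@connected_set_root _ _ sym _ (x i)) => t /RP[->|->|[j ->]|[j ji ->]] //.
    by apply: connect_trans iz _; apply: induced_edge_connect; rewrite // sym.
  by apply: induced_edge_connect; rewrite ?yR ?exy // eq_sym.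
(* By colour, [b] can only be adjacent to [z] and the [y j] with [j != i], all neighbours of
   [x i]. *)
have xi_b t : t \in R -> e b t -> e (x i) t.
  move=> /RP[->|->|[j ->]|[j ji ->]] //.
  - by rewrite irr.
  - by move/colP; rewrite cb cx eqxx.
  - by rewrite exy eq_sym.
have [|w ew] := CHH_common_neighbour (f := fun t => if t == b then x i else t) (y i) chh cR.
  move=> s t sR tR; case: eqP => [->|_]; case: eqP => [->|_] //.
  - by rewrite irr.
  - exact: xi_b.
  - by rewrite sym [in X in _ -> X]sym; apply: xi_b.
have [j] := nox w; rewrite sym.
have [->|ji] := eqVneq j i.
  by have := ew b bR; rewrite sym eqxx => ->.
have := ew (x j) (xR j); rewrite exy ji => /(_ isT).
by rewrite eq_sym (negPf (nbx j)) => ->.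
Qed.

(** No edge leaves the crown on either side, so by connectedness it is the whole graph. *)
Lemma crown_isomorphic n (x y : 'I_n -> T) c (t : T) :
  (forall a b, col a = col b -> exists w, e a w && e b w) ->
  (forall i j, e (x i) (y j) = (i != j)) ->
  (forall i, col (x i) = c) ->
  (forall w, exists i, ~~ e w (x i)) ->
  3 <= n /\ isomorphic e (@bcpm_rel n).
Proof.
move=> near exy cx nox.
have third := crown_third near cx nox.
have [i0 _] := nox t.
have n3 : 2 < n.
  have [i1 /andP[i10 _]] := third i0 i0; have [i2 /andP[i20 i21]] := third i0 i1.
  rewrite -val_eqE /= in i10; rewrite -!val_eqE /= in i20 i21.
  by have := ltn_ord i0; have := ltn_ord i1; have := ltn_ord i2; arith.
have eyx i j : e (y i) (x j) = (i != j) by rewrite sym exy eq_sym.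
have cy i : col (y i) = ~~ c.
  have [k /andP[ki _]] := third i i; have := exy k i.
  by rewrite ki => /colP; rewrite cx; case: c (col _) {cx} => [] [].
have yN := crown_neighbours near exy cx nox.
(* A common neighbour of all [y i] would be some [x j], which is not adjacent to [y j]; thus the two
   sides play symmetric roles. *)
have noy w : exists i, ~~ e w (y i).
  apply/existsP; rewrite -negb_forall; apply/negP => /forallP ewy.
  have [|j wj] := yN i0 w; first by rewrite sym.
  by have := ewy j; rewrite wj exy eqxx.
have xN := crown_neighbours near eyx cy noy.
have injx : injective x.
  by move=> i j xij; apply/eqP/negPn; rewrite -(exy i j) xij exy eqxx.
have injy : injective y.
  by move=> i j yij; apply/eqP/negPn; rewrite -(eyx i j) yij eyx eqxx.
pose f (s : 'I_n + 'I_n) := match s with inl i => x i | inr i => y i end.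
have surj v : exists s, v = f s.
  case/connectP: (conn (x i0) v) => p.
  have : exists s, x i0 = f s by exists (inl i0).
  elim: p (x i0) => [|b p IH] a fa /=; first by move=> _ ->.
  case/andP=> eab; apply: IH; case: fa eab => [[i|i] ->] /=.
    by case/xN=> j ->; exists (inr j).
  by case/yN=> j ->; exists (inl j).
have injf : injective f.
  move=> [i|i] [j|j] /=; first by move/injx->.
  - by move=> xy; have := cx i; rewrite xy cy; case: c {cx cy}.
  - by move=> yx; have := cy i; rewrite yx cx; case: c {cx cy}.
  - by move/injy->.
split=> //; exists f; split.
  apply: (inj_card_bij injf); rewrite -(card_codom injf).
  by apply/subset_leq_card/subsetP => v _; have [s ->] := surj v; apply: codom_f.
have neq a b : col a = col b -> e a b = false.
  by move=> ab; apply: contraTF isT => /colP; rewrite ab eqxx.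
by move=> [i|i] [j|j] /=; rewrite ?exy ?eyx // 1?eq_sym // neq ?cx ?cy.
Qed.

Lemma near_dichotomy (t : T) :
  (forall a b, col a = col b -> exists w, e a w && e b w) ->
  case_iv e \/ exists2 n, 3 <= n & isomorphic e (@bcpm_rel n).
Proof.
move=> near.
pose dominated c := [exists w, forall x in [set x | col x == c], e w x].
have crown c : ~~ dominated c -> exists2 n, 3 <= n & isomorphic e (@bcpm_rel n).
  rewrite negb_exists => /forallP nodom.
  have [w _|n [x [y [xX _ exy nox]]]] := @ex_crown _ _ sym [set x | col x == c] setT.
    by have := nodom w; rewrite negb_forall_in => /exists_inP[a aX na]; exists a.
  have cx i : col (x i) = c by have := xX i; rewrite inE => /eqP.
  have noxT w : exists i, ~~ e w (x i) by apply: nox; rewrite inE.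
  by have [n3 iso] := crown_isomorphic t near exy cx noxT; exists n.
case: (boolP (dominated true)) => [/existsP[u /forall_inP uX]|/crown]; last by right.
case: (boolP (dominated false)) => [/existsP[w /forall_inP wY]|/crown]; last by right.
left; exists [set x | col x == true], [set x | col x == false]; split.
- split.
  + by rewrite -setI_eq0; apply/eqP/setP => x; rewrite !inE; case: (col x).
  + by apply/setP => x; rewrite !inE; case: (col x).
  + by move=> a b; rewrite !inE => /eqP ca /eqP cb; apply/negP => /colP; rewrite ca cb.
  + by move=> a b; rewrite !inE => /eqP ca /eqP cb; apply/negP => /colP; rewrite ca cb.
- by exists u.
- by exists w.
Qed.

Lemma bipartite_cases (t : T) :
  case_iii e \/ case_iv e \/ exists2 n, 3 <= n & isomorphic e (@bcpm_rel n).
Proof.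
pose near := [forall a, forall b, (col a == col b) ==> [exists w, e a w && e b w]].
have [/forallP nearP|not_near] := boolP near.
  right; apply: near_dichotomy => // a b cab; apply/existsP.
  by have /forallP/(_ b)/implyP := nearP a; apply; apply/eqP.
(* Here [v] may have further neighbours on the path, so that the two-squares graph is covered as
   well as long holes. *)
have no_long_walk m p v : 3 < m -> induced_path e m p -> e v (p 0) -> e v (p m) -> False.
  move=> m4 ip ev0 evm; case/negP: not_near.
  apply/forallP => a; apply/forallP => b; apply/implyP => /eqP cab; apply/existsP.
  by apply: (even_walk_common_neighbour m4 _ cab); apply: walk_common_neighbour ip ev0 evm.
left; split=> [k c ic|[f [injf ef]]].
  have [k3 _ _] := ic; have [v [p [ip vp evp]]] := induced_cycle_path ic.
  have ev0 : e v (p 0) by rewrite evp.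
  have evm : e v (p (k - 2)) by rewrite evp // eqxx orbT.
  have [k5|k5] := ltnP 5 k; first by case: (no_long_walk _ _ _ _ ip ev0 evm); arith.
  have parity i : i <= k - 2 -> col (p i) = odd i (+) col (p 0).
    elim: i => // i IH ik; have := colP (induced_path_step sym irr ip ik).
    by rewrite IH 1?ltnW //=; case: (col _); case: (col _); case: (odd i).
  (* Both ends of the path have the colour opposite to [v], which excludes cycles of length 3 and
     5. *)
  have := parity _ (leqnn (k - 2)); have := colP ev0; have := colP evm.
  have [->//|] : k = 4 \/ (k = 3 \/ k = 5) by arith.
  by case=> -> /=; do 3!case: (col _).
(* The chord ends at vertex 5, so vertices 0 to 4 form an induced path, whose two ends are adjacent
   to 5. *)
pose p i := f (inord i : 'I_6).
have ip : induced_path e 4 p.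
  move=> i j ij; rewrite /p (inj_eq injf) ef /two_squares_rel /cycle_rel -val_eqE /=.
  by rewrite !inordK; arith.
apply: (no_long_walk 4 p (f (inord 5))) => //.
all: by rewrite /p ef /two_squares_rel /cycle_rel /= !inordK.
Qed.

End Bipartite.

End Necessity.

(** * Assembly of the cases, with the one-vertex graph apart *)

Theorem theorem1p2 (T : finType) (e : rel T) :
  simple_graph e -> connected_graph e ->
  (CHH e <->
   (#|T| = 1) \/
   (exists2 n, 2 <= n & Kn_treelike e n) \/
   case_iii e \/
   case_iv e \/
   (exists2 n, 3 <= n & isomorphic e (@bcpm_rel n))).
Proof.
move=> [sym irr] [T0 conn].
have [T1|T1] := leqP #|T| 1.
  have T_eq (x y : T) : x = y by apply: (fintype_le1P T1).
  split=> [_|_]; first by left; apply/eqP; rewrite eqn_leq T1 T0.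
  (* On a single vertex there is no [v] outside a set containing [s]. *)
  apply: CHH_of_one_point => // S f s v _ _ sS; rewrite (T_eq v s) sS //.
have [x [y nxy]] : exists x y : T, x != y.
  by have /card_gt1P[x [y [_ _ nxy]]] := T1; exists x, y.
have nbr v := neighbour_of_connected conn v nxy.
split=> [chh|].
  right; case: (boolP [exists a, exists b, exists c, [&& e a b, e a c & e b c]]).
    case/existsP=> a /existsP[b /existsP[c /and3P[eab eac ebc]]].
    by left; apply: triangle_treelike eab eac ebc.
  move=> tf; right; have [z exz] := nbr x.
  have [|col colP] := triangle_free_two_colourable sym irr conn chh exz.
    move=> a b c eab eac ebc; case/negP: tf; apply/existsP; exists a.
    by apply/existsP; exists b; apply/existsP; exists c; rewrite eab eac.
  exact: (bipartite_cases sym irr conn chh colP nbr x).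
case=> [T_eq1|]; first by rewrite T_eq1 in T1.
case=> [[n _]|]; first exact: treelike_CHH.
case=> [iii|]; first exact: squares_CHH.
case=> [[X [Y [[dXY XY nX nY] [u uX] [w wY]]]]|[n _]]; last exact: crown_CHH.
have XYC v : (v \in Y) = (v \notin X).
  have : v \in X :|: Y by rewrite XY inE.
  by rewrite inE; case: (boolP (v \in X)) => //= vX _; apply: (disjointFr dXY).
apply: (@CHH_of_common_neighbours _ e sym irr conn (mem X) _ u w) => [a b eab|a aX|a aX].
- apply: contraTneq eab => /= ab; case: (boolP (a \in X)) => aX.
    by apply: nX => //; rewrite -ab.
  by apply: nY; rewrite XYC -?ab.
- exact: uX.
- by apply: wY; rewrite XYC.
Qed.
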